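(* Let $M\subseteq\mathbb{R}^r$ be a submanifold and $\Pi^s$ its smooth metric projection, defined on a tubular neighbourhood $N$ of (an open subset $U$ of) $M$. If an SDE on $N$ fibres over $\Pi^s$, then the Stratonovich projection and the It\^o-jet projection of this SDE onto $M$ are both equal to the SDE induced by $\Pi^s$.
   Context: SDEs and $2$-jets: let $W^1,\dots,W^m$ be independent standard Brownian motions. A family of smooth maps $\gamma_x:\mathbb{R}^m\to P$ into a manifold $P$ with $\gamma_x(0)=x$, depending smoothly on $x\in P$, determines the It\^o SDE on $P$ given in any chart by $dX^i_t=\frac12\sum_{\alpha}\frac{\partial^2\gamma^i}{\partial u^\alpha\partial u^\alpha}(X_t)\,dt+\sum_\alpha\frac{\partial\gamma^i}{\partial u^\alpha}(X_t)\,dW^\alpha_t$ (derivatives of $\gamma_{X_t}$ at $0\in\mathbb{R}^m$). It depends only on the $2$-jets $j_2(\gamma_x)$ at $0$. Fibring: let $f:P\to Q$ be a smooth map between manifolds and $S$ the SDE on $P$ determined by the $2$-jets $\gamma_x:\mathbb{R}^m\to P$. $S$ fibres over $f$ if $j_2(f\circ\gamma_{x_1})=j_2(f\circ\gamma_{x_2})$ whenever $f(x_1)=f(x_2)$. In that case the SDE induced by $f$ is the SDE on the image of $f$ defined by the $2$-jets $j_2(f\circ\gamma_x)$ at the point $f(x)$. Metric projection: $\Pi^s$ sends a point of the tubular neighbourhood to the nearest point of the submanifold. It\^o-jet projection: if an SDE is given by maps $\gamma_x$, its It\^o-jet projection onto $M$ is the SDE on $M$ determined by the maps $\Pi^s\circ\gamma_y$,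 $y\in M$. Stratonovich projection: write the SDE in Stratonovich form $dX=\bar a\,dt+b_\alpha\circ dW^\alpha_t$; its Stratonovich projection is the Stratonovich SDE on $M$ whose coefficients at $x\in M$ are the vectors $\Pi_x\bar a(x)$ and $\Pi_xb_\alpha(x)$ of $T_xM$, where $\Pi_x:\mathbb{R}^r\to T_xM$ is the Euclidean orthogonal projection. Equality of SDEs means equality of coefficients after conversion to the same (It\^o or Stratonovich) form. *)

(* Defs.v *)
From mathcomp Require Export all_boot all_order all_algebra.
From mathcomp Require Export all_classical all_reals all_analysis.
Export numFieldNormedType.Exports.
Export Order.TTheory GRing.Theory Num.Theory.

Local Open Scope classical_set_scope.
Local Open Scope ring_scope.

(* C^k and C^oo on an open set A, for finite-dimensional V and W: there the
   differential is C^k as soon as each of its values 'D_v f, v fixed, is C^k. *)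
Fixpoint Ck_on {R : realType} {V W : normedModType R} (k : nat) (A : set V)
    (f : V -> W) : Prop :=
  match k with
  | 0 => forall x, A x -> {for x, continuous f}
  | k'.+1 => (forall x, A x -> differentiable f x) /\
             forall v : V, Ck_on k' A ('D_v f)
  end.

Definition smooth_on {R : realType} {V W : normedModType R} (A : set V)
    (f : V -> W) : Prop := forall k, Ck_on k A f.

(* The library norm on 'rV[R]_r is the sup norm, hence the Euclidean structure
   is introduced separately. *)
Definition dotp {R : realType} {r : nat} (v w : 'rV[R]_r) : R :=
  \sum_(i < r) v 0 i * w 0 i.

Definition enorm {R : realType} {r : nat} (v : 'rV[R]_r) : R :=
  Num.sqrt (dotp v v).

Definition ebase {R : realType} {n : nat} (i : 'I_n) : 'rV[R]_n := delta_mx 0 i.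

Record chart (R : realType) (r d : nat) := Chart {
  cdom : set 'rV[R]_r;
  ccod : set ('rV[R]_d * 'rV[R]_(r - d));
  cfwd : 'rV[R]_r -> 'rV[R]_d * 'rV[R]_(r - d);
  cbwd : 'rV[R]_d * 'rV[R]_(r - d) -> 'rV[R]_r }.

Arguments cdom {R r d} c.
Arguments ccod {R r d} c.
Arguments cfwd {R r d} c.
Arguments cbwd {R r d} c.

(* A diffeomorphism between open sets of R^r and R^d x R^(r-d) that flattens
   M; its restriction x |-> (cfwd c x).1 to M is a chart of the manifold M,
   with inverse w |-> cbwd c (w, 0). *)
Definition slice_chart {R : realType} {r d : nat} (M : set 'rV[R]_r)
    (c : chart R r d) : Prop :=
  [/\ open (cdom c) /\ open (ccod c),
      smooth_on (cdom c) (cfwd c) /\ smooth_on (ccod c) (cbwd c),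
      (forall x, cdom c x -> ccod c (cfwd c x) /\ cbwd c (cfwd c x) = x),
      (forall z, ccod c z -> cdom c (cbwd c z) /\ cfwd c (cbwd c z) = z) &
      (forall x, cdom c x -> (M x <-> (cfwd c x).2 = 0))].

Definition submanifold {R : realType} {r : nat} (d : nat) (M : set 'rV[R]_r)
    : Prop :=
  forall x, M x -> exists2 c : chart R r d, slice_chart M c & cdom c x.

Definition rel_open {R : realType} {r : nat} (M U : set 'rV[R]_r) : Prop :=
  exists2 O : set 'rV[R]_r, open O & U = M `&` O.

Definition tangent {R : realType} {r : nat} (M : set 'rV[R]_r) (x : 'rV[R]_r)
    : set 'rV[R]_r :=
  [set v | exists (e : R) (c : R -> 'rV[R]_r),
     [/\ 0 < e, smooth_on [set` `]- e, e[] c, (forall t, t \in `]- e, e[ -> M (c t)),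
         c 0 = x & derive1 c 0 = v]].

Definition normal_bundle {R : realType} {r : nat} (M : set 'rV[R]_r)
    : set ('rV[R]_r * 'rV[R]_r) :=
  [set p | M p.1 /\ forall w, tangent M p.1 w -> dotp p.2 w = 0].

(* N is open and (y, v) |-> y + v is a diffeomorphism onto N from an open
   neighbourhood V, with star-shaped fibres, of the zero section of the normal
   bundle of M; its inverse is x |-> (rho x, x - rho x). *)
Definition tubular_nbhd {R : realType} {r : nat} (M N : set 'rV[R]_r) : Prop :=
  open N /\
  exists (V O : set ('rV[R]_r * 'rV[R]_r)) (rho : 'rV[R]_r -> 'rV[R]_r),
    [/\ open O /\ V = normal_bundle M `&` O,
        (forall y, M y -> V (y, 0)),
        (forall y v (t : R), V (y, v) -> 0 <= t <= 1 -> V (y, t *: v)),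
        (forall y v, V (y, v) -> N (y + v) /\ rho (y + v) = y) &
        smooth_on N rho /\ (forall x, N x -> V (rho x, x - rho x))].

Definition metric_projection {R : realType} {r : nat} (M N : set 'rV[R]_r)
    (Pi : 'rV[R]_r -> 'rV[R]_r) : Prop :=
  forall x, N x ->
    M (Pi x) /\ forall q, M q -> q <> Pi x -> enorm (x - Pi x) < enorm (x - q).

(* The orthogonal projection of v onto the tangent space of M at x (the unique
   p below, for x in a submanifold M). *)
Definition tangent_proj {R : realType} {r : nat} (M : set 'rV[R]_r)
    (x v : 'rV[R]_r) : 'rV[R]_r :=
  get [set p | tangent M x p /\ forall w, tangent M x w -> dotp (v - p) w = 0].

(* Coefficients on (an open subset of) R^n of an SDE driven by m independent
   standard Brownian motions, in Ito or in Stratonovich form. *)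
Record coefs (R : realType) (n m : nat) := Coefs {
  drift : 'rV[R]_n -> 'rV[R]_n;
  diffusion : 'I_m -> 'rV[R]_n -> 'rV[R]_n }.

Arguments Coefs {R n m}.
Arguments drift {R n m} c.
Arguments diffusion {R n m} c.

(* (1/2) sum_alpha sum_j b_alpha^j d_j b_alpha, the difference between the Ito
   and the Stratonovich drifts. *)
Definition ito_correction {R : realType} {n m : nat}
    (b : 'I_m -> 'rV[R]_n -> 'rV[R]_n) (x : 'rV[R]_n) : 'rV[R]_n :=
  2^-1 *: \sum_(a < m) 'D_(b a x) (b a) x.

Definition strat_of_ito {R : realType} {n m : nat} (S : coefs R n m)
    : coefs R n m :=
  Coefs (fun x => drift S x - ito_correction (diffusion S) x) (diffusion S).

Definition ito_of_strat {R : realType} {n m : nat} (S : coefs R n m)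
    : coefs R n m :=
  Coefs (fun x => drift S x + ito_correction (diffusion S) x) (diffusion S).

(* g x : R^m -> R^n is the map gamma_x. *)
Definition ito_of_jets {R : realType} {n m : nat}
    (g : 'rV[R]_n -> 'rV[R]_m -> 'rV[R]_n) : coefs R n m :=
  Coefs (fun x => 2^-1 *: \sum_(a < m) 'D_(ebase a) ('D_(ebase a) (g x)) 0)
        (fun a x => 'D_(ebase a) (g x) 0).

Definition jet_family {R : realType} {n m : nat} (P : set 'rV[R]_n)
    (g : 'rV[R]_n -> 'rV[R]_m -> 'rV[R]_n) : Prop :=
  [/\ (forall x u, P x -> P (g x u)),
      (forall x, P x -> g x 0 = x) &
      smooth_on (P `*` [set: 'rV[R]_m])
        (fun z : 'rV[R]_n * 'rV[R]_m => g z.1 z.2)].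

(* j_2(g) = j_2(h) at 0 *)
Definition eq_jet2 {R : realType} {m n : nat} (g h : 'rV[R]_m -> 'rV[R]_n)
    : Prop :=
  [/\ g 0 = h 0,
      (forall i : 'I_m, 'D_(ebase i) g 0 = 'D_(ebase i) h 0) &
      (forall i j : 'I_m, 'D_(ebase i) ('D_(ebase j) g) 0
                        = 'D_(ebase i) ('D_(ebase j) h) 0)].

Definition fibres {R : realType} {r q m : nat} (P : set 'rV[R]_r)
    (f : 'rV[R]_r -> 'rV[R]_q) (g : 'rV[R]_r -> 'rV[R]_m -> 'rV[R]_r) : Prop :=
  forall x1 x2, P x1 -> P x2 -> f x1 = f x2 -> eq_jet2 (f \o g x1) (f \o g x2).

(* The family h on the image of f represents the SDE induced by f: the 2-jet
   of h at f(x) is that of f o gamma_x, whatever the point x of the fibre. *)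
Definition induced_jets {R : realType} {r q m : nat} (P : set 'rV[R]_r)
    (f : 'rV[R]_r -> 'rV[R]_q) (g : 'rV[R]_r -> 'rV[R]_m -> 'rV[R]_r)
    (h : 'rV[R]_q -> 'rV[R]_m -> 'rV[R]_q) : Prop :=
  forall x, P x ->
    [/\ smooth_on [set: 'rV[R]_m] (h (f x)),
        (forall u, (f @` P) (h (f x) u)) &
        eq_jet2 (h (f x)) (f \o g x)].

(* An SDE on a submanifold: its Ito coefficients in every slice chart. *)
Definition manifold_sde (R : realType) (r d m : nat) := chart R r d -> coefs R d m.

Definition sde_of_jets {R : realType} {r m : nat} (d : nat)
    (g : 'rV[R]_r -> 'rV[R]_m -> 'rV[R]_r) : manifold_sde R r d m :=
  fun c => ito_of_jets (fun w u => (cfwd c (g (cbwd c (w, 0)) u)).1).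

Definition push_field {R : realType} {r d : nat} (c : chart R r d)
    (X : 'rV[R]_r -> 'rV[R]_r) (w : 'rV[R]_d) : 'rV[R]_d :=
  let x := cbwd c (w, 0) in ('D_(X x) (cfwd c) x).1.

(* S has vector fields tangent to M as coefficients; the Stratonovich equation
   is expressed in the chart before conversion, so that only derivatives along
   M are taken. *)
Definition sde_of_strat {R : realType} {r m : nat} (d : nat) (S : coefs R r m)
    : manifold_sde R r d m :=
  fun c => ito_of_strat
    (Coefs (push_field c (drift S)) (fun a => push_field c (diffusion S a))).

(* Equality, over the open subset U of M, of SDEs on M. *)
Definition eq_sde {R : realType} {r d m : nat} (M U : set 'rV[R]_r)
    (S T : manifold_sde R r d m) : Prop :=
  forall c : chart R r d, slice_chart M c ->
  forall w : 'rV[R]_d, ccod c (w, 0) -> U (cbwd c (w, 0)) ->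
    drift (S c) w = drift (T c) w /\
    forall a, diffusion (S c) a w = diffusion (T c) a w.

Definition ito_jet_projection {R : realType} {r m : nat} (d : nat)
    (Pi : 'rV[R]_r -> 'rV[R]_r) (g : 'rV[R]_r -> 'rV[R]_m -> 'rV[R]_r)
    : manifold_sde R r d m :=
  sde_of_jets d (fun y => Pi \o g y).

Definition stratonovich_projection {R : realType} {r m : nat} (d : nat)
    (M : set 'rV[R]_r) (g : 'rV[R]_r -> 'rV[R]_m -> 'rV[R]_r)
    : manifold_sde R r d m :=
  let S := strat_of_ito (ito_of_jets g) in
  sde_of_strat d
    (Coefs (fun x => tangent_proj M x (drift S x))
           (fun a x => tangent_proj M x (diffusion S a x))).

(* Main.v *)
From HB Require Import structures.
Require Import Defs.

(** The retraction Pi restricts to the identity on U, and its derivative at a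
point y of U is the orthogonal projection of R^r onto the tangent space of M
at y ([tangent_projE]): x - Pi x is orthogonal to the tangent space at Pi x
because Pi x minimises the distance, and differentiating this orthogonality at
a point where x - Pi x vanishes gives the claim.

Let p be the coordinate map of a slice chart restricted to M, phi its local
inverse, gamma_x the maps that define the SDE, b_a(x) the derivative of gamma_x
along e_a at 0, and F = p o Pi. Projecting b_a onto the tangent space and
reading the result in the chart yields B_a o phi, where B_a = D_(b_a) F. Since
B_a(x) is the first derivative of p o (Pi o gamma_x) at 0, the fibring
hypothesis gives B_a = B_a o Pi near M ([fibring_diffusion]). As
phi o F = Pi, it follows that B_a = (B_a o phi) o F, so that the derivative of
the projected field B_a o phi along itself is the derivative of B_a along b_a,
a derivative in the ambient space ([derive_projected_diffusion]). Expanding it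
by the product rule,

  D_(b_a) B_a = D_(D_(b_a) b_a) F + D_(b_a) D_(b_a) F,

the first term is what the Stratonovich correction removes from the ambient Ito
drift before projection, and the second is the term that the second-order chain
rule produces for F o gamma. Hence the Stratonovich projection has the Ito
coefficients of F o gamma, that is, of the Ito-jet projection
([stratonovich_eq_ito_jet]). The latter agrees with the induced SDE because
composition with p preserves equality of 2-jets ([ito_jet_eq_induced]). *)

Local Open Scope classical_set_scope.
Local Open Scope ring_scope.

(** * Directional derivatives *)

Lemma near_eq_differentiable {R : realType} {V W : normedModType R}
    (f g : V -> W) (x : V) :
  (\near x, f x = g x) -> differentiable f x -> differentiable g x.
Proof.
move=> fg df.
have dfc : continuous ('d f x) by exact: diff_continuous.
have gx : g x = f x by rewrite (nbhs_singleton fg).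
have go : g \o shift x = cst (g x) + 'd f x +o_ 0 id.
  have /eqaddoP fo := diff_locally df.
  apply/eqaddoP => e e0; have := fo e e0.
  have fg0 : \forall y \near (0 : V), f (y + x) = g (y + x).
    by rewrite (near_shift x) /=; near do rewrite /= sub0r addrNK//.
  apply: filterS2 fg0 => y /= fgy.
  by rewrite !fctE /= fgy gx.
by apply/diff_locallyP; rewrite (diff_unique dfc go).
Unshelve. all: by end_near. Qed.

(** The product rule for a scalar function times a vector function comes from
the differential of a bilinear map, once scaling is declared to be one. *)
Section scale_bilinear.
Context {R : realType} {W : normedModType R}.
Let sc (a : R^o) (w : W) : W := a *: w.
Let sc_bilinear : bilinear_for *:%R *:%R sc.
Proof.
split=> [w|a] b x y; rewrite /sc.
- by rewrite scalerDl; congr (_ + _); exact/esym/scalerA.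
- rewrite scalerDr; congr (_ + _).
  by rewrite scalerA mulrC; exact/esym/scalerA.
Qed.
HB.instance Definition _ :=
  bilinear_isBilinear.Build R R^o W W _ _ sc sc_bilinear.

Lemma is_diff_scale {V : normedModType R} (a : V -> R^o) (w : V -> W) (x : V) :
  differentiable a x -> differentiable w x ->
  is_diff x (fun y => a y *: w y) (fun v => a x *: 'd w x v + 'd a x v *: w x).
Proof.
move=> da dw.
have scc : continuous (fun p => sc p.1 p.2) by exact: scale_continuous.
have -> : (fun y => a y *: w y) =
    (fun p => sc p.1 p.2) \o (fun y => (a y, w y)).
  by [].
have dp : differentiable (fun y => (a y, w y)) x by exact: differentiable_pair.
have ds : differentiable (fun p => sc p.1 p.2) (a x, w x).
  exact: differentiable_bilin.
apply: DiffDef; first exact: differentiable_comp.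
by rewrite diff_comp // diff_bilin // diff_pair.
Qed.
End scale_bilinear.

Lemma differentiable_scale {R : realType} {V W : normedModType R}
    {a : V -> R} {w : V -> W} {x : V} :
  differentiable a x -> differentiable w x ->
  differentiable (fun y => a y *: w y) x.
Proof. by move=> da dw; have [] := is_diff_scale a w x da dw. Qed.

Lemma derive_scale {R : realType} {V W : normedModType R}
    {a : V -> R} {w : V -> W} {x : V} (v : V) :
  differentiable a x -> differentiable w x ->
  'D_v (fun y => a y *: w y) x = a x *: 'D_v w x + 'D_v a x *: w x.
Proof.
move=> da dw; have [d e] := is_diff_scale a w x da dw.
by rewrite !deriveE // e.
Qed.

Lemma derive_comp {R : realType} {U V W : normedModType R}
    {h : U -> V} {f : V -> W} {x : U} (v : U) :
  differentiable h x -> differentiable f (h x) ->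
  'D_v (f \o h) x = 'D_('D_v h x) f (h x).
Proof.
move=> dh df; rewrite !deriveE //; last exact: differentiable_comp.
by rewrite diff_comp.
Qed.

Lemma row_ebase {R : realType} {n : nat} (v : 'rV[R]_n) :
  v = \sum_i v 0 i *: ebase i.
Proof. exact: row_sum_delta. Qed.

Lemma derive_basis {R : realType} {n : nat} {W : normedModType R}
    {f : 'rV[R]_n -> W} {x : 'rV[R]_n} (v : 'rV[R]_n) :
  differentiable f x -> 'D_v f x = \sum_i v 0 i *: 'D_(ebase i) f x.
Proof.
move=> df; rewrite deriveE // {1}(row_ebase v) linear_sum.
by apply: eq_bigr => i _; rewrite linearZ deriveE.
Qed.

Lemma differentiable_row_coord {R : realType} {n : nat} {V : normedModType R}
    {k : V -> 'rV[R]_n} {x : V} (i : 'I_n) :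
  differentiable k x -> differentiable (fun y => k y 0 i) x.
Proof.
move=> dk; rewrite -[fun y => _]/((fun N : 'rV_n => N 0 i) \o k).
by apply: differentiable_comp dk _; exact: differentiable_coord.
Qed.

Lemma derive_row_coord {R : realType} {n : nat} {V : normedModType R}
    {k : V -> 'rV[R]_n} {x : V} (v : V) (i : 'I_n) :
  differentiable k x -> 'D_v (fun y => k y 0 i) x = ('D_v k x) 0 i.
Proof. by move=> dk; rewrite (derive_mx (diff_derivable dk)) mxE. Qed.

(** The pointwise regularity under which second derivatives obey the chain rule;
in finite dimension it says that f is differentiable near x with a differential
that is differentiable at x. *)
Definition differentiable2 {R : realType} {V W : normedModType R}
    (f : V -> W) (x : V) :=
  (\forall y \near x, differentiable f y) /\
  forall v, differentiable ('D_v f) x.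

(** A product rule: 'D_(k y) f (h y) pairs the differential of f at h y with
the vector k y. The expansion of k y in the canonical basis turns the pairing
into a finite sum of products. With k a derivative of h this is the second-order
chain rule, and with h the identity it differentiates a vector field applied to
f. *)
Lemma moving_direction {R : realType} {n : nat} {V W : normedModType R}
    {f : 'rV[R]_n -> W} {h k : V -> 'rV[R]_n} {x : V} :
  differentiable2 f (h x) -> differentiable h x -> differentiable k x ->
  differentiable (fun y => 'D_(k y) f (h y)) x /\
  forall v, 'D_v (fun y => 'D_(k y) f (h y)) x =
    'D_('D_v k x) f (h x) + 'D_('D_v h x) ('D_(k x) f) (h x).
Proof.
move=> [df d2f] dh dk.
pose G i y := k y 0 i *: 'D_(ebase i) f (h y).
have eG : \forall y \near x, (\sum_i G i) y = 'D_(k y) f (h y).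
  have dfh : \forall y \near x, differentiable f (h y).
    exact: (differentiable_continuous dh df).
  apply: filterS dfh => y dfy.
  by rewrite (derive_basis _ dfy) fct_sumE.
have dk' i := differentiable_row_coord i dk.
have dfi i : differentiable ('D_(ebase i) f \o h) x.
  exact: differentiable_comp dh (d2f _).
have dG i : differentiable (G i) x.
  exact: (differentiable_scale (dk' i) (dfi i)).
have dfx : differentiable f (h x) by exact: nbhs_singleton df.
have ek : \forall y \near h x,
    (\sum_i k x 0 i *: 'D_(ebase i) f) y = 'D_(k x) f y.
  apply: filterS df => y dfy.
  by rewrite (derive_basis _ dfy) fct_sumE.
split=> [|v].
  by apply: near_eq_differentiable eG _; exact: differentiable_sum.
rewrite -(near_eq_derive v eG) -(near_eq_derive _ ek).
rewrite derive_sum => [|i]; last exact: diff_derivable.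
rewrite derive_sum => [|i]; last first.
  by apply: diff_derivable; exact: differentiableZ.
rewrite (derive_basis _ dfx) -big_split; apply: eq_bigr => i _ /=.
rewrite (derive_scale v (dk' i) (dfi i)) (derive_row_coord _ _ dk).
rewrite (derive_comp v dh (d2f _)) addrC.
by rewrite deriveZ //; apply: diff_derivable; exact: d2f.
Qed.

(** * Smoothness and twofold differentiability *)

Lemma near_open {T : topologicalType} {A : set T} {x : T} :
  open A -> A x -> \forall y \near x, A y.
Proof. by move=> oA Ax; apply: open_nbhs_nbhs. Qed.

Lemma smooth_differentiable {R : realType} {V W : normedModType R}
    {A : set V} {f : V -> W} {x : V} :
  smooth_on A f -> A x -> differentiable f x.
Proof. by move=> /(_ 1%N)[+ _]; exact. Qed.

Lemma differentiable2W {R : realType} {V W : normedModType R}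
    {f : V -> W} {x : V} :
  differentiable2 f x -> differentiable f x.
Proof. by move=> [df _]; exact: nbhs_singleton df. Qed.

Lemma smooth_differentiable2 {R : realType} {V W : normedModType R}
    {A : set V} {f : V -> W} {x : V} :
  open A -> smooth_on A f -> A x -> differentiable2 f x.
Proof.
move=> oA fs Ax; have [df d2f] := fs 2%N; split.
  by apply: filterS (near_open oA Ax) => y; exact: df.
by move=> v; have [d _] := d2f v; exact: d.
Qed.

(** The definition by iterated derivatives is a statement about germs, hence
needs A to be open. *)
Lemma Ck_on_eq {R : realType} {V W : normedModType R} k {A : set V}
    {f g : V -> W} :
  open A -> (forall x, A x -> f x = g x) -> Ck_on k A f -> Ck_on k A g.
Proof.
move=> oA; elim: k f g => [|k IH] f g fg /= => [fc x Ax|[df dkf]].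
  suff: g @ x --> f x by rewrite (fg _ Ax).
  apply: cvg_trans (fc x Ax).
  by apply: near_eq_cvg; apply: filterS (near_open oA Ax) => y /fg.
have nfg x : A x -> \forall y \near x, f y = g y.
  by move=> Ax; apply: filterS (near_open oA Ax) => y /fg.
split=> [x Ax|v].
  exact: near_eq_differentiable (nfg x Ax) (df x Ax).
apply: IH (dkf v) => x Ax; exact: near_eq_derive (nfg x Ax).
Qed.

(** A constant differential (independent of x) makes h affine, so that every
derivative of f o h along v is again of the form g o h, with g the derivative
of f along L v: the induction needs no product rule. *)
Lemma Ck_on_affine {R : realType} {U V W : normedModType R} k
    {A : set V} {B : set U} {h : U -> V} {L : U -> V} {f : V -> W} :
  open B -> (forall x, B x -> A (h x)) ->
  (forall x, is_diff x h L) -> Ck_on k A f -> Ck_on k B (f \o h).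
Proof.
move=> oB hBA dh; elim: k f => [|k IH] f /= => [fc x Bx|[df dkf]].
  apply: continuous_comp (fc _ (hBA _ Bx)).
  by apply: differentiable_continuous; have [] := dh x.
have dhx x : differentiable h x by have [] := dh x.
split=> [x Bx|v].
  exact: differentiable_comp (dhx x) (df _ (hBA _ Bx)).
have := IH _ (dkf (L v)); apply: Ck_on_eq oB _ => x Bx /=.
rewrite (derive_comp v (dhx x) (df _ (hBA _ Bx))) (deriveE _ (dhx x)).
by have [_ ->] := dh x.
Qed.

Lemma smooth_on_affine {R : realType} {U V W : normedModType R}
    {A : set V} {B : set U} {h L : U -> V} {f : V -> W} :
  open B -> (forall x, B x -> A (h x)) ->
  (forall x, is_diff x h L) -> smooth_on A f -> smooth_on B (f \o h).
Proof. by move=> oB BA dh fs k; apply: Ck_on_affine oB BA dh (fs k). Qed.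

Lemma is_diff_pairl {R : realType} {V W : normedModType R} (w : W) (x : V) :
  is_diff x (fun y => (y, w)) (fun v => (v, 0)).
Proof.
apply: DiffDef; first by apply: differentiable_pair.
by rewrite diff_pair // !diff_val.
Qed.

Lemma is_diff_pairr {R : realType} {V W : normedModType R} (v : V) (x : W) :
  is_diff x (fun y => (v, y)) (fun w => (0, w)).
Proof.
apply: DiffDef; first by apply: differentiable_pair.
by rewrite diff_pair // !diff_val.
Qed.

Lemma is_diff_line {R : realType} {V : normedModType R} (p v : V) (t : R) :
  is_diff t (fun s : R => p + s *: v) (fun s => s *: v).
Proof.
have -> : (fun s : R => p + s *: v) = cst p + (fun s => s *: v) by [].
by apply: is_diff_eq; rewrite add0r.
Qed.

Lemma differentiable2_near_differentiable {R : realType} {n : nat}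
    {V W : normedModType R} {f : 'rV[R]_n -> W} {h : V -> 'rV[R]_n} {x : V} :
  differentiable2 h x -> differentiable2 f (h x) ->
  \forall y \near x, differentiable h y /\ differentiable f (h y).
Proof.
move=> [dh _] [df _].
have dhx : differentiable h x by exact: nbhs_singleton dh.
have dfh : \forall y \near x, differentiable f (h y).
  exact: (differentiable_continuous dhx df).
by apply: filterS2 dh dfh => y dhy dfy; split.
Qed.

Lemma derive_comp_near {R : realType} {n : nat}
    {V W : normedModType R} {f : 'rV[R]_n -> W} {h : V -> 'rV[R]_n} {x : V}
    (v : V) :
  differentiable2 h x -> differentiable2 f (h x) ->
  \forall y \near x, 'D_('D_v h y) f (h y) = 'D_v (f \o h) y.
Proof.
move=> dh df.
apply: filterS (differentiable2_near_differentiable dh df) => y [dhy dfy].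
by rewrite (derive_comp v dhy dfy).
Qed.

Lemma differentiable2_comp {R : realType} {n : nat} {V W : normedModType R}
    {f : 'rV[R]_n -> W} {h : V -> 'rV[R]_n} {x : V} :
  differentiable2 h x -> differentiable2 f (h x) -> differentiable2 (f \o h) x.
Proof.
move=> dh df; split.
  apply: filterS (differentiable2_near_differentiable dh df) => y [dhy dfy].
  exact: differentiable_comp.
move=> v; apply: near_eq_differentiable (derive_comp_near v dh df) _.
have dhx : differentiable h x by exact: nbhs_singleton dh.1.
by have [] := moving_direction df dhx (dh.2 v).
Qed.

Lemma derive2_comp {R : realType} {n : nat} {V W : normedModType R}
    {f : 'rV[R]_n -> W} {h : V -> 'rV[R]_n} {x : V} (v w : V) :
  differentiable2 h x -> differentiable2 f (h x) ->
  'D_v ('D_w (f \o h)) x =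
    'D_('D_v ('D_w h) x) f (h x) + 'D_('D_v h x) ('D_('D_w h x) f) (h x).
Proof.
move=> dh df; rewrite -(near_eq_derive _ (derive_comp_near w dh df)).
have dhx : differentiable h x by exact: nbhs_singleton dh.1.
by have [_ ->] := moving_direction df dhx (dh.2 w).
Qed.

Lemma is_diff_fst {R : realType} {V W : normedModType R} (z : V * W) :
  is_diff z fst fst.
Proof.
have fc : continuous (fst : V * W -> V) by move=> ?; exact: cvg_fst.
apply: DiffDef; first exact: linear_differentiable.
exact: diff_lin.
Qed.

Lemma differentiable_fst {R : realType} {U V W : normedModType R}
    {f : U -> V * W} {x : U} :
  differentiable f x -> differentiable (fun y => (f y).1) x.
Proof.
move=> df; have [dfst _] := is_diff_fst (f x).
exact: (differentiable_comp df dfst).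
Qed.

Lemma derive_fst {R : realType} {U V W : normedModType R}
    {f : U -> V * W} {x : U} (v : U) :
  differentiable f x -> 'D_v (fun y => (f y).1) x = ('D_v f x).1.
Proof.
move=> df; have [dfst e] := is_diff_fst (f x).
by rewrite (derive_comp v df dfst) deriveE // e.
Qed.

Lemma differentiable2_fst {R : realType} {U V W : normedModType R}
    {f : U -> V * W} {x : U} :
  differentiable2 f x -> differentiable2 (fun y => (f y).1) x.
Proof.
move=> [df d2f]; split.
  by apply: filterS df => y; exact: differentiable_fst.
move=> v; apply: near_eq_differentiable (differentiable_fst (d2f v)).
by apply: filterS df => y dfy; rewrite derive_fst.
Qed.

(** * The metric projection *)

Lemma dotpC {R : realType} {r : nat} (v w : 'rV[R]_r) : dotp v w = dotp w v.
Proof. by apply: eq_bigr => i _; rewrite mulrC. Qed.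

Lemma dotpBl {R : realType} {r : nat} (u v w : 'rV[R]_r) :
  dotp (u - v) w = dotp u w - dotp v w.
Proof.
rewrite /dotp -sumrB; apply: eq_bigr => i _.
by rewrite !mxE mulrDl mulNr.
Qed.

Lemma dotpNr {R : realType} {r : nat} (v w : 'rV[R]_r) :
  dotp v (- w) = - dotp v w.
Proof. by rewrite /dotp -sumrN; apply: eq_bigr => i _; rewrite mxE mulrN. Qed.

Lemma dotp0l {R : realType} {r : nat} (v : 'rV[R]_r) : dotp 0 v = 0.
Proof. by rewrite /dotp big1 // => i _; rewrite mxE mul0r. Qed.

Lemma dotp_ge0 {R : realType} {r : nat} (v : 'rV[R]_r) : 0 <= dotp v v.
Proof. by apply: sumr_ge0 => i _; exact: sqr_ge0. Qed.

Lemma dotp_eq0 {R : realType} {r : nat} (v : 'rV[R]_r) : dotp v v = 0 -> v = 0.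
Proof.
move=> v0; apply/rowP => i; rewrite mxE.
have v2 j : true -> 0 <= v 0 j * v 0 j by move=> _; exact: sqr_ge0.
have := psumr_eq0P v2 v0 (i := i) isT.
by move=> /eqP; rewrite mulf_eq0 orbb => /eqP.
Qed.

Lemma derive_dotp {R : realType} {r : nat} {V : normedModType R}
    {k h : V -> 'rV[R]_r} {x : V} :
  differentiable k x -> differentiable h x ->
  differentiable (fun y => dotp (k y) (h y) : R) x /\
  forall v, 'D_v (fun y => dotp (k y) (h y)) x =
    dotp ('D_v k x) (h x) + dotp (k x) ('D_v h x).
Proof.
move=> dk dh.
have -> : (fun y => dotp (k y) (h y)) =
    \sum_i ((fun y => k y 0 i) * (fun y => h y 0 i)).
  by apply/funext => y; rewrite fct_sumE.
have dki i := differentiable_row_coord i dk.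
have dhi i := differentiable_row_coord i dh.
have dp i : differentiable ((fun y => k y 0 i) * (fun y => h y 0 i)) x.
  exact: differentiableM.
split=> [|v]; first exact: differentiable_sum.
rewrite derive_sum => [|i]; last exact: diff_derivable.
rewrite -big_split; apply: eq_bigr => i _ /=.
rewrite deriveM; [|exact: diff_derivable..].
rewrite (derive_row_coord _ _ dk) (derive_row_coord _ _ dh) addrC.
by congr (_ + _); rewrite mulrC.
Qed.

Section metric_projection.
Context {R : realType} {r : nat} {M U N : set 'rV[R]_r}
  {Pi : 'rV[R]_r -> 'rV[R]_r}.
Hypotheses (UM : rel_open M U) (oN : open N) (UN : U `<=` N).
Hypotheses (mPi : metric_projection U N Pi) (sPi : smooth_on N Pi).

Lemma metric_projection_fix y : U y -> Pi y = y.
Proof.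
move=> Uy; apply: contrapT => /nesym ney.
have [_ /(_ y Uy ney)] := mPi _ (UN _ Uy).
by rewrite subrr /enorm dotp0l sqrtr0 ltNge sqrtr_ge0.
Qed.

Lemma line_in_nbhd p v : N p ->
  exists2 e : R, 0 < e & forall t, t \in `]- e, e[ -> N (p + t *: v).
Proof.
move=> Np.
have [dl _] := is_diff_line p v 0.
have := differentiable_continuous dl; rewrite /= => lc.
have Np0 : nbhs (p + 0 *: v) N.
  by rewrite scale0r addr0; exact: (near_open oN Np).
have [e /= e0 eN] := lc N Np0.
exists e => // t; rewrite in_itv /= => te.
by apply: eN; rewrite /= sub0r normrN ltr_norml.
Qed.

(** For small t, the curve t |-> Pi (Pi x + t w) lies in U; it passes through
Pi x at t = 0, where its distance to x is minimal: the derivative of the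
squared distance vanishes there. *)
Lemma metric_projection_perp x w : N x -> dotp (x - Pi x) ('D_w Pi (Pi x)) = 0.
Proof.
move=> Nx; have [UPx min_x] := mPi _ Nx.
have NPx := UN _ UPx.
have [e e0 eN] := line_in_nbhd (Pi x) w NPx.
pose c t := x - Pi (Pi x + t *: w).
have dc t : t \in `]- e, e[ -> differentiable c t.
  move=> te; apply: differentiableB => //.
  have [dl _] := is_diff_line (Pi x) w t.
  apply: (differentiable_comp dl); exact: smooth_differentiable sPi (eN t te).
have e0' : (0 : R) \in `]- e, e[ by rewrite in_itv /= oppr_lt0 e0.
have c0 : c 0 = x - Pi x.
  by rewrite /c scale0r addr0 (metric_projection_fix _ UPx).
have Dc : 'D_1 c 0 = - 'D_w Pi (Pi x).
  have [dl el] := is_diff_line (Pi x) w 0.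
  have dP : differentiable Pi (Pi x + 0 *: w).
    exact: smooth_differentiable sPi (eN 0 e0').
  rewrite deriveB; [|exact: derivable_cst|]; last first.
    by apply: diff_derivable; exact: (differentiable_comp dl dP).
  rewrite derive_cst sub0r (derive_comp (1 : R) dl dP) (deriveE _ dl) el.
  by rewrite scale1r scale0r addr0.
have : is_derive (0 : R) 1 (fun t => dotp (c t) (c t) : R) 0.
  apply: (@derive1_at_min _ _ (- e) e) => //.
  - by rewrite ge0_cp // ltW.
  - move=> t te; apply: diff_derivable.
    by have [] := derive_dotp (dc t te) (dc t te).
  - move=> t te; rewrite c0 /c; set q := Pi (_ + _).
    have Uq : U q by exact: (mPi _ (eN t te)).1.
    have [->//|/eqP nq] := eqVneq q (Pi x).
    have := ltW (min_x q Uq nq).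
    by rewrite ler_sqrt // dotp_ge0.
move=> [_]; have [_ ->] := derive_dotp (dc 0 e0') (dc 0 e0').
rewrite c0 Dc [dotp (- _) _]dotpC dotpNr -opprD => /eqP.
by rewrite oppr_eq0 -mulr2n mulrn_eq0 /= => /eqP.
Qed.

(** Differentiate the identity of [metric_projection_perp] at y along v: the
term where the second factor is differentiated has y - Pi y = 0 as a factor. *)
Lemma derive_metric_projection_perp y v w :
  U y -> dotp (v - 'D_v Pi y) ('D_w Pi y) = 0.
Proof.
move=> Uy; have Ny := UN _ Uy; have Py := metric_projection_fix _ Uy.
have [nP d2P] : differentiable2 Pi y by exact: smooth_differentiable2 sPi Ny.
have dP : differentiable Pi y by exact: nbhs_singleton nP.
have dk : differentiable (fun x => x - Pi x) y by exact: differentiableB.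
have d2Py : differentiable ('D_w Pi) (Pi y) by rewrite Py; exact: d2P.
have dh : differentiable (fun x => 'D_w Pi (Pi x)) y.
  exact: (differentiable_comp dP d2Py).
have [_ /(_ v)] := derive_dotp dk dh.
rewrite Py subrr dotp0l addr0.
rewrite deriveB; [|exact: derivable_id|exact: diff_derivable].
rewrite derive_id => <-.
rewrite (near_eq_derive (g := cst 0)) ?derive_cst //.
by apply: filterS (near_open oN Ny) => x; exact: metric_projection_perp.
Qed.

(** The curve t |-> Pi (y + t v) in M has the required velocity. *)
Lemma derive_metric_projection_tangent y v : U y -> tangent M y ('D_v Pi y).
Proof.
move=> Uy; have Ny := UN _ Uy.
have [e e0 eN] := line_in_nbhd y v Ny.
have Dl t := is_diff_line y v t.
exists e, (fun t => Pi (y + t *: v)); split=> //.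
- have oI : open [set` `]- e, e[] by exact: itv_open.
  exact: (smooth_on_affine oI eN Dl sPi).
- move=> t te; have := (mPi _ (eN t te)).1.
  by have [A _ UA] := UM; rewrite UA => -[].
- by rewrite scale0r addr0 metric_projection_fix.
have [dl el] := Dl 0.
have dP : differentiable Pi (y + 0 *: v).
  by rewrite scale0r addr0; exact: smooth_differentiable sPi Ny.
rewrite derive1E (derive_comp (1 : R) dl dP) (deriveE _ dl) el.
by rewrite scale1r scale0r addr0.
Qed.

(** Pi fixes every curve that represents w near its base point. *)
Lemma derive_metric_projection_fix y w :
  U y -> tangent M y w -> 'D_w Pi y = w.
Proof.
move=> Uy [e [c [e0 sc Mc c0 <-]]].
have e0' : (0 : R) \in `]- e, e[ by rewrite in_itv /= oppr_lt0 e0.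
have dc : differentiable c 0 by exact: smooth_differentiable sc e0'.
have dP : differentiable Pi (c 0).
  by rewrite c0; exact: smooth_differentiable sPi (UN _ Uy).
rewrite -{1}c0 derive1E -(derive_comp (1 : R) dc dP).
have [A oA UA] := UM.
apply: near_eq_derive.
have Oc : \forall t \near (0 : R), A (c t).
  apply: (differentiable_continuous dc); apply: near_open oA _.
  by rewrite c0; move: Uy; rewrite UA => -[].
have ne : \forall t \near (0 : R), t \in `]- e, e[.
  by apply: near_open (itv_open _ _) e0'.
apply: filterS2 Oc ne => t Oct /Mc Mct; apply: metric_projection_fix.
by rewrite UA.
Qed.

(** Together with uniqueness of the orthogonal decomposition, the three facts
above identify the derivative of Pi at points of U. *)
Lemma tangent_projE y v : U y -> tangent_proj M y v = 'D_v Pi y.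
Proof.
move=> Uy; rewrite /tangent_proj.
set P := [set p | _]; have Pv : P ('D_v Pi y).
  split=> [|w Tw]; first exact: derive_metric_projection_tangent.
  rewrite -(derive_metric_projection_fix _ _ Uy Tw).
  exact: derive_metric_projection_perp.
have [Tp pp] := getI Pv.
have [Tq qq] := Pv.
apply/subr0_eq/dotp_eq0.
set p := get P in Tp pp *; set q := 'D_v Pi y in Tq qq *.
(* p - q is orthogonal to the tangent vectors p and q, hence to itself. *)
have pq w : tangent M y w -> dotp (p - q) w = 0.
  move=> Tw; have -> : p - q = (v - q) - (v - p).
    by rewrite opprB [RHS]addrC addrA subrK.
  by rewrite dotpBl pp // qq // subrr.
by rewrite dotpBl ![dotp _ (p - q)]dotpC !pq // subrr.
Qed.

End metric_projection.

(** * Jets and the coefficients they determine *)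

Lemma eq_jet2_comp {R : realType} {m n d : nat}
    {h k : 'rV[R]_m -> 'rV[R]_n} {f : 'rV[R]_n -> 'rV[R]_d} :
  eq_jet2 h k -> differentiable2 h 0 -> differentiable2 k 0 ->
  differentiable2 f (h 0) ->
  eq_jet2 (f \o h) (f \o k).
Proof.
move=> [hk0 hk1 hk2] dh dk df.
have df' : differentiable2 f (k 0) by rewrite -hk0.
split=> [|i|i j]; first by rewrite /= hk0.
  rewrite (derive_comp _ (differentiable2W dh) (differentiable2W df)).
  rewrite (derive_comp _ (differentiable2W dk) (differentiable2W df')).
  by rewrite hk1 hk0.
by rewrite (derive2_comp _ _ dh df) (derive2_comp _ _ dk df') !hk1 hk2 hk0.
Qed.

Lemma ito_of_jets_eq {R : realType} {m n : nat}
    {g h : 'rV[R]_n -> 'rV[R]_m -> 'rV[R]_n} {x : 'rV[R]_n} :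
  eq_jet2 (g x) (h x) ->
  drift (ito_of_jets g) x = drift (ito_of_jets h) x /\
  forall a, diffusion (ito_of_jets g) a x = diffusion (ito_of_jets h) a x.
Proof.
move=> [_ e1 e2]; split=> [|a] /=; last exact: e1.
by apply: f_equal; apply: eq_bigr => a _; exact: e2.
Qed.

Section jet_family.
Context {R : realType} {n m : nat} {P : set 'rV[R]_n}
  {g : 'rV[R]_n -> 'rV[R]_m -> 'rV[R]_n}.
Hypotheses (oP : open P) (jg : jet_family P g).

Lemma jet_family_differentiable2 x : P x -> differentiable2 (g x) 0.
Proof.
move=> Px; have [_ _ sg] := jg.
have sgx : smooth_on setT (g x).
  have oT : open [set: 'rV[R]_m] := openT.
  apply: (smooth_on_affine oT _ (is_diff_pairr x) sg).
  by move=> u _; split.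
exact: smooth_differentiable2 openT sgx I.
Qed.

(** The diffusion fields are the partial derivatives of the joint map
(x, u) |-> g x u in the second variable, restricted to u = 0. *)
Lemma jet_family_diffusion_differentiable x a :
  P x -> differentiable (diffusion (ito_of_jets g) a) x.
Proof.
move=> Px; have [_ _ sg] := jg; set G := (fun z => _) in sg.
have oPT : open (P `*` [set: 'rV[R]_m]).
  have -> : P `*` [set: 'rV[R]_m] = fst @^-1` P.
    by apply/seteqP; split=> [z []|z Pz].
  by apply: open_comp oP => z _; exact: cvg_fst.
have P0 y : P y -> (P `*` [set: 'rV[R]_m]) (y, 0) by move=> Py; split.
have dG : differentiable2 G (x, 0).
  exact: (smooth_differentiable2 oPT sg (P0 x Px)).
have [dl _] := is_diff_pairl (0 : 'rV[R]_m) x.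
have := differentiable_comp dl (dG.2 (0, ebase a)).
apply: near_eq_differentiable; apply: filterS (near_open oP Px) => y Py /=.
have [dr er] := is_diff_pairr y (0 : 'rV[R]_m).
have dGy : differentiable G (y, 0) := smooth_differentiable sg (P0 y Py).
by rewrite -[g y]/(G \o pair y) (derive_comp _ dr dGy) (deriveE _ dr) er.
Qed.

End jet_family.

(** The Ito drift of a projected Stratonovich equation: f is the differential
of the projection in coordinates, s the second derivatives of the jets, u the
derivatives of the diffusion fields along themselves, and e the second-order
terms of the projection. *)
Lemma correction_cancel {R : realType} {V W : lmodType R} {m : nat}
    (f : {linear V -> W}) (s u : 'I_m -> V) (e : 'I_m -> W) :
  f (2^-1 *: \sum_a s a - 2^-1 *: \sum_a u a)
    + 2^-1 *: \sum_a (f (u a) + e a) = 2^-1 *: \sum_a (f (s a) + e a).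
Proof.
rewrite !big_split -!linear_sum linearB /= !linearZ /= !scalerDr.
by rewrite scalerN addrA subrK.
Qed.

(** * The projections in a slice chart *)

Section projected_sde.
Context {R : realType} {r d m : nat} {M U N : set 'rV[R]_r}
  {Pi : 'rV[R]_r -> 'rV[R]_r} {g : 'rV[R]_r -> 'rV[R]_m -> 'rV[R]_r}.
Hypotheses (UM : rel_open M U) (oN : open N) (UN : U `<=` N).
Hypotheses (mPi : metric_projection U N Pi) (sPi : smooth_on N Pi).
Hypotheses (jg : jet_family N g) (fg : fibres N Pi g).
Context {c : chart R r d}.
Hypothesis cM : slice_chart M c.

Let PiU y : U y -> Pi y = y := metric_projection_fix UN mPi y.
Let p x := (cfwd c x).1.
Let phi w := cbwd c (w, 0).
Let F := p \o Pi.
Let b a x := 'D_(ebase a) (g x) 0.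
Let B a x := 'D_(b a x) F x.

Lemma chart_coord_differentiable2 x : cdom c x -> differentiable2 p x.
Proof.
move=> cx; have [[oc _] [sf _] _ _ _] := cM.
exact: differentiable2_fst (smooth_differentiable2 oc sf cx).
Qed.

Lemma chart_param_differentiable2 w : ccod c (w, 0) -> differentiable2 phi w.
Proof.
move=> cw; have [[_ oc] [_ sb] _ _ _] := cM.
have oW : open [set w | ccod c (w, 0)].
  pose j (v : 'rV[R]_d) : 'rV[R]_d * 'rV[R]_(r - d) := (v, 0).
  rewrite -[X in open X]/(j @^-1` ccod c).
  apply: open_comp oc => x _.
  have [dl _] := is_diff_pairl (0 : 'rV[R]_(r - d)) x.
  exact: (differentiable_continuous dl).
have sphi : smooth_on [set w | ccod c (w, 0)] phi.
  have hW w' : [set w | ccod c (w, 0)] w' -> ccod c (w', 0) by [].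
  exact: (smooth_on_affine oW hW (is_diff_pairl 0) sb).
exact: smooth_differentiable2 oW sphi cw.
Qed.

Lemma retraction_coord_differentiable2 x :
  N x -> cdom c (Pi x) -> differentiable2 F x.
Proof.
move=> Nx cx.
have dP : differentiable2 Pi x by exact: smooth_differentiable2 oN sPi Nx.
exact: differentiable2_comp dP (chart_coord_differentiable2 _ cx).
Qed.

Lemma near_retraction_cdom y :
  U y -> cdom c y -> \forall x \near y, N x /\ cdom c (Pi x).
Proof.
move=> Uy cy; have Ny := UN _ Uy.
have [[oc _] _ _ _ _] := cM.
have dP : differentiable Pi y by exact: smooth_differentiable sPi Ny.
have cP : \forall x \near y, cdom c (Pi x).
  apply: (differentiable_continuous dP); apply: near_open oc _.
  by rewrite PiU.
by apply: filterS2 (near_open oN Ny) cP => x Nx cx; split.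
Qed.

(** Pi x lies in M, so that its chart coordinates are (F x, 0). *)
Lemma chart_param_retraction x : N x -> cdom c (Pi x) -> phi (F x) = Pi x.
Proof.
move=> Nx cx; have [_ _ fb _ flat] := cM.
have MP : M (Pi x).
  have := (mPi _ Nx).1; have [A _ UA] := UM; by rewrite UA => -[].
have p2 : (cfwd c (Pi x)).2 = 0 by apply/flat.
rewrite /phi /F /p /= -[in RHS](fb _ cx).2; congr cbwd.
by rewrite [RHS]surjective_pairing p2.
Qed.

Lemma chart_paramK w : ccod c (w, 0) -> cdom c (phi w) /\ p (phi w) = w.
Proof.
move=> cw; have [_ _ _ bf _] := cM; have [? e] := bf _ cw.
by split; rewrite /p ?e.
Qed.

(** U is relatively open in M and phi is continuous with values in M, hence
the conditions on w persist nearby; this allows differentiation in the chart. *)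
Lemma near_chart_param w : ccod c (w, 0) -> U (phi w) ->
  \forall v \near w, ccod c (v, 0) /\ U (phi v).
Proof.
move=> cw Uw; have [[_ oc] _ _ _ flat] := cM.
have [A oA UA] := UM.
have dphi : differentiable phi w.
  exact: differentiable2W (chart_param_differentiable2 _ cw).
have Aw : \forall v \near w, A (phi v).
  apply: (differentiable_continuous dphi); apply: near_open oA _.
  by move: Uw; rewrite UA => -[].
have cv : \forall v \near w, ccod c (v, 0).
  have [dl _] := is_diff_pairl (0 : 'rV[R]_(r - d)) w.
  by apply: (differentiable_continuous dl); apply: near_open oc _.
apply: filterS2 Aw cv => v Av cv; split=> //; rewrite UA; split=> //.
have [_ _ _ bf _] := cM; have [cpv e] := bf _ cv.
by apply/(flat _ cpv); rewrite e.
Qed.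

(** By [tangent_projE], projecting X and pushing it to the chart amounts to
applying the differentials of Pi and p in succession. *)
Lemma push_tangent_proj (X : 'rV[R]_r -> 'rV[R]_r) w :
  ccod c (w, 0) -> U (phi w) ->
  push_field c (fun x => tangent_proj M x (X x)) w = 'D_(X (phi w)) F (phi w).
Proof.
move=> cw Uw; rewrite /push_field -/(phi w).
have [cx _] := chart_paramK _ cw; set y := phi w in Uw cx *.
rewrite (tangent_projE UM oN UN mPi sPi _ _ Uw).
have [[oc _] [sf _] _ _ _] := cM.
have df : differentiable (cfwd c) y by exact: smooth_differentiable sf cx.
have dP : differentiable Pi y by exact: smooth_differentiable sPi (UN _ Uw).
rewrite -(derive_fst _ df) -/p (derive_comp _ dP) PiU //.
exact: differentiable_fst.
Qed.

(** x and Pi x lie in the same fibre of Pi, and B a z is determined by the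
first-order part of the 2-jet of Pi o g z. *)
Lemma fibring_diffusion a x : N x -> cdom c (Pi x) -> B a (Pi x) = B a x.
Proof.
move=> Nx cx.
have UP := (mPi _ Nx).1; have NP := UN _ UP; have PP := PiU _ UP.
have [_ g0 _] := jg.
have jet z : N z -> cdom c (Pi z) ->
    B a z = 'D_('D_(ebase a) (Pi \o g z) 0) p (Pi z).
  move=> Nz cz.
  have dg := differentiable2W (jet_family_differentiable2 jg _ Nz).
  have dP : differentiable Pi (g z 0).
    by rewrite g0 //; exact: smooth_differentiable sPi Nz.
  have dp : differentiable p (Pi z) :=
    differentiable2W (chart_coord_differentiable2 _ cz).
  have -> : 'D_(ebase a) (Pi \o g z) 0 = 'D_(b a z) Pi z.
    by rewrite (derive_comp (ebase a) dg dP) g0.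
  exact: (derive_comp (b a z) (smooth_differentiable sPi Nz) dp).
have [_ e1 _] := fg _ _ NP Nx PP.
have cPx : cdom c (Pi (Pi x)) by rewrite PP.
by rewrite (jet _ NP cPx) (jet _ Nx cx) PP e1.
Qed.

(** The ambient expansion of the derivative of B a, in which the Ito correction
D_(b a) (b a) appears. *)
Lemma diffusion_coord_differentiable a y : U y -> cdom c y ->
  differentiable (B a) y /\
  forall v, 'D_v (B a) y = 'D_('D_v (b a) y) F y + 'D_v ('D_(b a y) F) y.
Proof.
move=> Uy cy; have Ny := UN _ Uy.
have dF : differentiable2 F y.
  by apply: retraction_coord_differentiable2 => //; rewrite PiU.
have db := jet_family_diffusion_differentiable oN jg _ a Ny.
have [dB eB] := @moving_direction _ _ _ _ F id (b a) y dF ex_diff db.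
split=> [|v]; first exact: dB.
by have := eB v; rewrite (derive_id y v).
Qed.

(** The Stratonovich correction in the chart: since B a o phi o F = B a near y
and F maps b a y to beta w, the derivative of beta along itself is the
derivative of B a along b a at y. *)
Lemma derive_projected_diffusion a w : ccod c (w, 0) -> U (phi w) ->
  let beta := push_field c (fun x => tangent_proj M x (b a x)) in
  let y := phi w in
  'D_(beta w) beta w =
    'D_('D_(b a y) (b a) y) F y + 'D_(b a y) ('D_(b a y) F) y.
Proof.
move=> cw Uw beta y; have [cy py] := chart_paramK _ cw.
have [dB eB] := diffusion_coord_differentiable a _ Uw cy.
have Fy : F y = w by rewrite /F /= PiU // py.
have ebeta : \forall v \near w, beta v = (B a \o phi) v.
  apply: filterS (near_chart_param _ cw Uw) => v [cv Uv].
  exact: push_tangent_proj.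
rewrite (near_eq_derive _ ebeta) [beta w]push_tangent_proj //.
have dFy : differentiable F y.
  apply: (differentiable2W (retraction_coord_differentiable2 _ (UN _ Uw) _)).
  by rewrite PiU.
have dBphi : differentiable (B a \o phi) (F y).
  rewrite Fy; apply: differentiable_comp dB.
  exact: differentiable2W (chart_param_differentiable2 _ cw).
rewrite -(eB (b a y)).
have -> : 'D_('D_(b a (phi w)) F (phi w)) (B a \o phi) w =
    'D_(b a y) ((B a \o phi) \o F) y.
  by rewrite (derive_comp (b a y) dFy dBphi) Fy.
apply: near_eq_derive.
apply: filterS (near_retraction_cdom _ Uw cy) => x [Nx cx] /=.
by rewrite chart_param_retraction // fibring_diffusion.
Qed.

(** Both sides have the Ito coefficients of the maps F o g y. *)
Lemma stratonovich_eq_ito_jet w : ccod c (w, 0) -> U (phi w) ->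
  drift (stratonovich_projection d M g c) w =
    drift (ito_jet_projection d Pi g c) w /\
  forall a, diffusion (stratonovich_projection d M g c) a w =
    diffusion (ito_jet_projection d Pi g c) a w.
Proof.
move=> cw Uw; set y := phi w in Uw *; have Ny := UN _ Uw.
have [cy _] := chart_paramK _ cw.
have [_ g0 _] := jg; have gy := g0 _ Ny.
have dg := jet_family_differentiable2 jg _ Ny.
have dF : differentiable2 F y.
  by apply: retraction_coord_differentiable2 => //; rewrite PiU.
have dF' : differentiable2 F (g y 0) by rewrite gy.
have dFy := differentiable2W dF.
pose beta a := push_field c (fun x => tangent_proj M x (b a x)).
split=> [|a].
  pose X x := drift (ito_of_jets g) x - ito_correction b x.
  rewrite -[LHS]/(push_field c (fun x => tangent_proj M x (X x)) w
    + 2^-1 *: \sum_a 'D_(beta a w) (beta a) w).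
  rewrite -[RHS]/(2^-1 *: \sum_a 'D_(ebase a) ('D_(ebase a) (F \o g y)) 0).
  have -> : \sum_a 'D_(beta a w) (beta a) w =
      \sum_a ('d F y ('D_(b a y) (b a) y) + 'D_(b a y) ('D_(b a y) F) y).
    apply: eq_bigr => a _; rewrite -(deriveE _ dFy).
    exact: (derive_projected_diffusion a _ cw Uw).
  have -> : \sum_a 'D_(ebase a) ('D_(ebase a) (F \o g y)) 0 =
      \sum_a ('d F y ('D_(ebase a) ('D_(ebase a) (g y)) 0)
               + 'D_(b a y) ('D_(b a y) F) y).
    apply: eq_bigr => a _; rewrite -(deriveE _ dFy).
    by rewrite (derive2_comp (ebase a) (ebase a) dg dF') gy.
  rewrite (push_tangent_proj X _ cw Uw) -/y (deriveE _ dFy).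
  exact: correction_cancel.
rewrite -[LHS]/(push_field c (fun x => tangent_proj M x (b a x)) w).
rewrite -[RHS]/('D_(ebase a) (F \o g y) 0) (push_tangent_proj (b a) _ cw Uw).
have dFg : differentiable F (g y 0) by rewrite gy.
by rewrite (derive_comp (ebase a) (differentiable2W dg) dFg) gy.
Qed.

(** At y in U the induced jet is that of Pi o g y, as Pi y = y; reading both in
the chart is composition with p. *)
Lemma ito_jet_eq_induced {h : 'rV[R]_r -> 'rV[R]_m -> 'rV[R]_r} w :
  induced_jets N Pi g h -> ccod c (w, 0) -> U (phi w) ->
  drift (ito_jet_projection d Pi g c) w = drift (sde_of_jets d h c) w /\
  forall a, diffusion (ito_jet_projection d Pi g c) a w =
    diffusion (sde_of_jets d h c) a w.
Proof.
move=> ih cw Uw; have Ny := UN _ Uw; have [cy _] := chart_paramK _ cw.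
set y := phi w in Uw Ny cy *; have [_ g0 _] := jg.
have := ih _ Ny; rewrite (PiU _ Uw) => -[sh _ [h0 h1 h2]].
have dh : differentiable2 (h y) 0 by exact: smooth_differentiable2 openT sh I.
have dP : differentiable2 Pi (g y 0).
  by rewrite g0 //; exact: smooth_differentiable2 oN sPi Ny.
have dk : differentiable2 (Pi \o g y) 0.
  exact: differentiable2_comp (jet_family_differentiable2 jg _ Ny) dP.
have k0 : (Pi \o g y) 0 = y by rewrite /= g0 // PiU.
have dp : differentiable2 p ((Pi \o g y) 0).
  by rewrite k0; exact: chart_coord_differentiable2.
have jet : eq_jet2 (Pi \o g y) (h y).
  by split=> [|i|i j]; [exact/esym/h0|exact/esym/h1|exact/esym/h2].
pose gP v u := (cfwd c (Pi (g (phi v) u))).1.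
pose hP v u := (cfwd c (h (phi v) u)).1.
have jetP : eq_jet2 (gP w) (hP w) := eq_jet2_comp jet dk dh dp.
exact: (ito_of_jets_eq jetP).
Qed.

End projected_sde.

Theorem theorem4 (R : realType) (r d m : nat) (M U N : set 'rV[R]_r)
    (Pi : 'rV[R]_r -> 'rV[R]_r)
    (gamma : 'rV[R]_r -> 'rV[R]_m -> 'rV[R]_r)
    (delta : 'rV[R]_r -> 'rV[R]_m -> 'rV[R]_r) :
  submanifold d M ->
  rel_open M U ->
  tubular_nbhd U N ->
  metric_projection U N Pi ->
  smooth_on N Pi ->
  jet_family N gamma ->
  fibres N Pi gamma ->
  induced_jets N Pi gamma delta ->
  eq_sde M U (stratonovich_projection d M gamma) (sde_of_jets d delta) /\
  eq_sde M U (ito_jet_projection d Pi gamma) (sde_of_jets d delta).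
Proof.
move=> _ UM [oN [V [W [rho [_ V0 _ VN _]]]]] mPi sPi jg fg ij.
have UN : U `<=` N.
  by move=> y Uy; rewrite -[y]addr0; exact: (VN _ _ (V0 y Uy)).1.
split=> c cM w cw Uw.
  have [-> es] := stratonovich_eq_ito_jet UM oN UN mPi sPi jg fg cM _ cw Uw.
  have [-> ei] := ito_jet_eq_induced oN UN mPi sPi jg cM _ ij cw Uw.
  by split=> [//|a]; exact: etrans (es a) (ei a).
exact: (ito_jet_eq_induced oN UN mPi sPi jg cM _ ij cw Uw).
Qed.
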